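(* For $G=\mathbb Z_3\times\mathbb Z_3$, $$\mathcal S(G)=\{9m\pm 1 : m\in\mathbb Z\}\cup\{3^6m : m\in\mathbb Z\}.$$
   Context: For a finite group $G=\{g_1,\dots,g_n\}$, assign an independent variable $x_g$ to each $g\in G$; the group determinant $\mathscr D_G(x_{g_1},\dots,x_{g_n})$ is the determinant of the $n\times n$ matrix whose $(i,j)$ entry is $x_{g_ig_j^{-1}}$. Define $\mathcal S(G)=\{\mathscr D_G(x_{g_1},\dots,x_{g_n}) : x_{g_i}\in\mathbb Z\}$. *)

(* Defs.v *)
From mathcomp Require Import all_boot all_algebra all_fingroup.
From mathcomp Require Import classical_sets.

Set Implicit Arguments.
Unset Strict Implicit.
Unset Printing Implicit Defensive.

Import GRing.Theory.

Local Open Scope classical_set_scope.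
Local Open Scope ring_scope.

(* The elements of [gT] are listed as [g_i := enum_val i]; the determinant does
   not depend on the chosen listing, since reordering it permutes the rows and
   the columns in the same way. *)
Definition group_matrix (gT : finGroupType) (R : comNzRingType) (x : gT -> R) :
    'M[R]_#|gT| :=
  \matrix_(i, j) x (enum_val i * (enum_val j)^-1)%g.

Definition group_det (gT : finGroupType) (R : comNzRingType) (x : gT -> R) : R :=
  \det (group_matrix x).

Definition group_det_set (gT : finGroupType) : set int :=
  [set group_det x | x in [set: gT -> int]].

(* Main.v *)
(** The group determinant is the product over the nine characters of their
    values on [F = sum_g x_g g].  Pairing conjugate characters, it is
    [S * N_1 * N_2 * N_3 * N_4], where [S = sum_g x_g] and [N_i] is the norm of
    [s_0 + s_1 w + s_2 w^2] with [s_0, s_1, s_2] the sums of [x] over the lines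
    of the [i]-th parallel class of the affine plane over F_3.  Moreover
    [N_i = S^2 - 3 e_i] with [e_i = s_0 s_1 + s_1 s_2 + s_2 s_0], and
    [e_1 + e_2 + e_3 + e_4] is divisible by 3.  Hence the determinant is [S^9]
    modulo 9.  If [3] divides [S], then every [e_i] is [0] or [-1] modulo 3, and
    they are not all [-1], which gives a sixth factor 3.  Conversely, adding a
    constant [m] to [x] changes [S] by [9 m] and leaves the [N_i] fixed, so five
    explicit arrays with [S = 1, -1, 0, 3, -3] suffice; the last three have
    norms with product [3^5]. *)

Require Import Defs.
From mathcomp Require Import all_boot all_order all_algebra all_fingroup all_field.
From mathcomp Require Import classical_sets.
From mathcomp Require Import ring zify.
Set Implicit Arguments.
Unset Strict Implicit.
Unset Printing Implicit Defensive.
Import Order.TTheory GRing.Theory Num.Theory.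
Local Open Scope classical_set_scope.
Local Open Scope ring_scope.

(** * Factorization of a group determinant over characters *)

Lemma group_det_morph (gT : finGroupType) (R S : comNzRingType)
    (f : {rmorphism R -> S}) (x : gT -> R) :
  f (group_det x) = group_det (f \o x).
Proof.
by rewrite /group_det -det_map_mx; congr (\det _); apply/matrixP => i j; rewrite !mxE.
Qed.

(** The character table [V] diagonalizes the group matrix, and orthogonality of its rows makes it
    invertible. *)
Lemma group_det_characters (gT : finGroupType) (R : idomainType)
    (chi : gT -> gT -> R) (x : gT -> R) :
  (forall c, chi c 1%g = 1) ->
  (forall c, {morph chi c : g h / (g * h)%g >-> g * h}) ->
  (forall g, g != 1%g -> \sum_c chi c g = 0) ->
  #|gT|%:R != 0 :> R ->
  group_det x = \prod_c \sum_g x g * chi c g^-1%g.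
Proof.
move=> chi1 chiM sum_chi nz_card.
pose V := \matrix_(i < #|gT|, j < #|gT|) chi (enum_val j) (enum_val i).
pose W := \matrix_(i < #|gT|, j < #|gT|) chi (enum_val i) (enum_val j)^-1%g.
pose d := \row_(j < #|gT|) \sum_g x g * chi (enum_val j) g^-1%g.
have VW : V *m W = #|gT|%:R%:M.
  apply/matrixP => i j; rewrite !mxE.
  transitivity (\sum_c chi c (enum_val i * (enum_val j)^-1)%g).
    rewrite [RHS](reindex_onto (@enum_val _ predT) enum_rank) /=; last first.
      by move=> c _; rewrite enum_rankK.
    apply: eq_big => [k|k _]; first by rewrite enum_valK eqxx.
    by rewrite !mxE chiM.
  have [<-|neq_ij] := eqVneq i j.
    rewrite mulgV (eq_bigr (fun _ => 1)) => [|c _]; last exact: chi1.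
    by rewrite sumr_const mulr1n.
  rewrite mulr0n sum_chi //; apply: contra neq_ij => /eqP gh1.
  by apply/eqP/enum_val_inj/eqP; rewrite eq_mulgV1 gh1.
have MV : group_matrix x *m V = V *m diag_mx d.
  apply/matrixP => i j; rewrite mul_mx_diag !mxE mulr_sumr.
  (* With [g = g_i g_k^-1], [chi c g_k] is [chi c g_i * chi c g^-1], so the columns of [V] are
     eigenvectors. *)
  rewrite [RHS](reindex_onto (fun k => enum_val i * (enum_val k)^-1)%g
            (fun g => enum_rank (g^-1 * enum_val i)%g)) /=; last first.
    by move=> g _; rewrite enum_rankK invMg invgK mulKVg.
  apply: eq_big => [k|k _].
    by rewrite invMg invgK mulgKV enum_valK eqxx.
  rewrite !mxE mulrCA; congr (_ * _).
  by rewrite mulrC -chiM invMg invgK mulgKV.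
have nzV : \det V != 0.
  have: \det V * \det W != 0 by rewrite -det_mulmx VW det_scalar expf_neq0.
  by rewrite mulf_eq0 negb_or => /andP[].
apply: (mulIf nzV); rewrite /group_det -det_mulmx MV det_mulmx det_diag mulrC.
congr (_ * _); rewrite [RHS](reindex_onto (@enum_val _ predT) enum_rank) /=.
  by apply: eq_big => [k|k _]; rewrite ?enum_valK ?eqxx // mxE.
by move=> c _; rewrite enum_rankK.
Qed.

(** * The nine characters of the group and their conjugate pairs *)

Lemma big_Z3 (R : Type) (idx : R) (op : Monoid.law idx) (f : 'Z_3 -> R) :
  \big[op/idx]_i f i = op (f 0) (op (f 1) (f (1 + 1))).
Proof.
rewrite !big_ord_recl big_ord0 Monoid.mulm1.
by congr (op (f _) (op (f _) (f _))); apply: val_inj.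
Qed.

Lemma big_Z3sq (R : Type) (idx : R) (op : Monoid.com_law idx)
    (f : 'Z_3 * 'Z_3 -> R) :
  \big[op/idx]_p f p = \big[op/idx]_i \big[op/idx]_j f (i, j).
Proof. by rewrite pair_bigA; apply: eq_bigr => -[]. Qed.

Definition eisenstein_norm (a b c : int) : int :=
  a ^+ 2 + b ^+ 2 + c ^+ 2 - a * b - b * c - c * a.

Lemma eisenstein_normE (w : algC) (a b c : int) : w ^+ 2 = - w - 1 ->
  (eisenstein_norm a b c)%:~R =
    (a%:~R + b%:~R * w + c%:~R * w ^+ 2) * (a%:~R + b%:~R * w ^+ 2 + c%:~R * w).
Proof.
move=> w2; rewrite /eisenstein_norm w2 !(rmorphB, rmorphD, rmorphM, rmorphXn) /=.
by ring: w2.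
Qed.

(** The exponent is a natural number, not reduced modulo 3; this is harmless once [w ^+ 3 = 1]. *)
Definition Z3sq_char (w : algC) (c g : 'Z_3 * 'Z_3) : algC :=
  w ^+ (c.1 * g.1 + c.2 * g.2).

Ltac reduce_exponents w :=
  repeat match goal with
  | |- context [w ^+ ?n] =>
    let m := eval vm_compute in n in tryif constr_eq n m then fail
    else change (w ^+ n) with (w ^+ m)
  end.

Lemma group_det_Z3sq (x : 'Z_3 * 'Z_3 -> int) :
  let a i j := x (i, j) in
  group_det x =
    (a 0 0 + a 0 1 + a 0 (1 + 1) + a 1 0 + a 1 1 + a 1 (1 + 1) +
     a (1 + 1) 0 + a (1 + 1) 1 + a (1 + 1) (1 + 1)) *
    (eisenstein_norm (a 0 0 + a 0 1 + a 0 (1 + 1))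
       (a 1 0 + a 1 1 + a 1 (1 + 1))
       (a (1 + 1) 0 + a (1 + 1) 1 + a (1 + 1) (1 + 1)) *
     eisenstein_norm (a 0 0 + a 1 0 + a (1 + 1) 0)
       (a 0 1 + a 1 1 + a (1 + 1) 1)
       (a 0 (1 + 1) + a 1 (1 + 1) + a (1 + 1) (1 + 1)) *
     eisenstein_norm (a 0 0 + a 1 (1 + 1) + a (1 + 1) 1)
       (a 0 1 + a 1 0 + a (1 + 1) (1 + 1))
       (a 0 (1 + 1) + a 1 1 + a (1 + 1) 0) *
     eisenstein_norm (a 0 0 + a 1 1 + a (1 + 1) (1 + 1))
       (a 0 1 + a 1 (1 + 1) + a (1 + 1) 0)
       (a 0 (1 + 1) + a 1 0 + a (1 + 1) 1)).
Proof.
move=> a.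
have [w prim_w] := C_prim_root_exists (isT : (0 < 3)%N).
have w3 : w ^+ 3 = 1 := prim_expr_order prim_w.
have w2 : w ^+ 2 = - w - 1.
  have nz : w - 1 != 0.
    by rewrite subr_eq0 -[w]expr1 -(prim_order_dvd prim_w).
  apply/eqP; rewrite -subr_eq0; apply/eqP; apply: (mulfI nz); ring: w3.
have wmod n : w ^+ (n %% 3) = w ^+ n by rewrite expr_mod.
apply: (@intr_inj algC); rewrite (group_det_morph (intr : {rmorphism int -> algC})).
rewrite (group_det_characters (chi := Z3sq_char w)).
(* Reducing exponents modulo 3 leaves only the powers of [w] that occur in [eisenstein_normE]. *)
- pose F (i j : 'Z_3) : algC := \sum_(k : 'Z_3) \sum_(l : 'Z_3)
      (a k l)%:~R * w ^+ ((i * (k^-1)%g + j * (l^-1)%g) %% 3)%N.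
  transitivity (\prod_i \prod_j F i j).
    rewrite big_Z3sq; apply: eq_bigr => i _; apply: eq_bigr => j _.
    rewrite /F [LHS]big_Z3sq.
    by apply: eq_bigr => k _; apply: eq_bigr => l _; rewrite wmod.
  rewrite !big_Z3.
  (* Each pair [c], [-c] of conjugate characters yields one norm, whose line sums run over the
     cosets of their common kernel. *)
  transitivity (F 0 0 * ((F (1 + 1) 0 * F 1 0) * (F 0 (1 + 1) * F 0 1) *
      (F (1 + 1) (1 + 1) * F 1 1) * (F 1 (1 + 1) * F (1 + 1) 1))).
    by rewrite /=; move: F => F; ring.
  rewrite !rmorphM /= !(eisenstein_normE _ _ _ w2).
  by congr (_ * (_ * _ * (_ * _) * (_ * _) * (_ * _)));
    rewrite /F !big_Z3 !rmorphD; reduce_exponents w; rewrite /=; ring.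
- by move=> c; rewrite /Z3sq_char !muln0.
- move=> c g h; rewrite /Z3sq_char -exprD.
  rewrite -[LHS]wmod -[RHS]wmod; congr (w ^+ _) => /=.
  rewrite -[LHS]modnDm !modnMmr modnDm !mulnDr.
  by rewrite addnACA.
- move=> [g1 g2] g_neq1.
  have sum0 (g : 'Z_3) : g != 0 -> \sum_(i : 'Z_3) w ^+ (i * g) = 0.
    rewrite big_Z3; case: g => [[|[|[|//]]] ?] // _;
      reduce_exponents w; rewrite /=; ring: w2.
  rewrite big_Z3sq /Z3sq_char /=.
  under eq_bigr do under eq_bigr do rewrite exprD.
  rewrite -big_distrlr /=.
  have /orP[/sum0->|/sum0->] : (g1 != 0) || (g2 != 0) by rewrite -negb_and.
    by rewrite mul0r.
  by rewrite mulr0.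
- by rewrite card_prod !card_ord pnatr_eq0.
Qed.

(** * Residues of the product of norms, and arrays attaining every value *)

Lemma eisenstein_norm_sum (a b c : int) :
  eisenstein_norm a b c = (a + b + c) ^+ 2 - 3 * (a * b + b * c + c * a).
Proof. by rewrite /eisenstein_norm; ring. Qed.

Lemma modz3_cases (n : int) :
  exists q : int, [\/ n = 3 * q, n = 3 * q + 1 | n = 3 * q - 1].
Proof.
have := divz_eq n 3; have := modz_ge0 n (isT : 3 != 0 :> int).
have := ltz_pmod n (isT : 0 < 3 :> int).
move: (n %/ 3)%Z (n %% 3)%Z => q r r_lt r_ge nE.
have [r0|[r1|r2]] : r = 0 \/ (r = 1 \/ r = 2) by lia.
- by exists q; apply: Or31; lia.
- by exists q; apply: Or32; lia.
- by exists (q + 1); apply: Or33; lia.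
Qed.

(* Modulo 3 the quantity [a b + b c + c a] is [- (a - b)^2]. *)
Lemma pair_sum_mod3 (a b c k : int) : a + b + c = 3 * k ->
  exists t : int, a * b + b * c + c * a = 3 * t \/ a * b + b * c + c * a = 3 * t - 1.
Proof.
move=> abcE; have -> : c = 3 * k - a - b by lia.
have [q dE] := modz3_cases (a - b).
have [abE|[abE|abE]] : a = b + 3 * q \/ (a = b + 3 * q + 1 \/ a = b + 3 * q - 1).
  by case: dE; lia.
- by exists (k * (a + b) - a * b - 3 * q ^+ 2); left; rewrite abE; ring.
- by exists (k * (a + b) - a * b - 3 * q ^+ 2 - 2 * q); right; rewrite abE; ring.
- by exists (k * (a + b) - a * b - 3 * q ^+ 2 + 2 * q); right; rewrite abE; ring.
Qed.

(** In the expansion in powers of [s], the coefficient of [s ^+ 7] is [-3 * (3 * e)]; all lower ones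
    carry at least two factors 3. *)
Lemma norm_product_coprime (s e1 e2 e3 e4 e : int) : e1 + e2 + e3 + e4 = 3 * e ->
  exists q : int, s * ((s ^+ 2 - 3 * e1) * (s ^+ 2 - 3 * e2) *
    (s ^+ 2 - 3 * e3) * (s ^+ 2 - 3 * e4)) = s ^+ 9 + 9 * q.
Proof.
move=> sumE; have -> : e4 = 3 * e - e1 - e2 - e3 by lia.
set f4 := 3 * e - e1 - e2 - e3.
exists (- s ^+ 7 * e + s ^+ 5 * (e1 * e2 + e1 * e3 + e2 * e3 + (e1 + e2 + e3) * f4)
  - 3 * s ^+ 3 * (e1 * e2 * e3 + (e1 * e2 + e1 * e3 + e2 * e3) * f4)
  + 9 * s * (e1 * e2 * e3 * f4)).
by rewrite /f4; ring.
Qed.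

Lemma norm_product_dvd3 (k e1 e2 e3 e4 e : int) : e1 + e2 + e3 + e4 = 3 * e ->
  (exists t : int, e1 = 3 * t \/ e1 = 3 * t - 1) ->
  (exists t : int, e2 = 3 * t \/ e2 = 3 * t - 1) ->
  (exists t : int, e3 = 3 * t \/ e3 = 3 * t - 1) ->
  (exists t : int, e4 = 3 * t \/ e4 = 3 * t - 1) ->
  exists m : int, (3 * k) * (((3 * k) ^+ 2 - 3 * e1) * ((3 * k) ^+ 2 - 3 * e2) *
    ((3 * k) ^+ 2 - 3 * e3) * ((3 * k) ^+ 2 - 3 * e4)) = 3 ^+ 6 * m.
Proof.
move=> sumE [t1 e1E] [t2 e2E] [t3 e3E] [t4 e4E].
(* [f e_i] is a norm divided by 3; when [e_i = 3 * t_i] the norm is [9 * (k ^+ 2 - t_i)]. *)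
pose f (u : int) := 3 * k ^+ 2 - u.
(* Four residues equal to [-1] would sum to [-1] modulo 3, so one is [0]. *)
have [->|[->|[->|->]]] :
  e1 = 3 * t1 \/ (e2 = 3 * t2 \/ (e3 = 3 * t3 \/ e4 = 3 * t4)) by lia.
- by exists (k * ((k ^+ 2 - t1) * f e2 * f e3 * f e4)); rewrite /f; ring.
- by exists (k * (f e1 * (k ^+ 2 - t2) * f e3 * f e4)); rewrite /f; ring.
- by exists (k * (f e1 * f e2 * (k ^+ 2 - t3) * f e4)); rewrite /f; ring.
- by exists (k * (f e1 * f e2 * f e3 * (k ^+ 2 - t4))); rewrite /f; ring.
Qed.

Lemma group_det_Z3sq_mod (x : 'Z_3 * 'Z_3 -> int) :
  (exists m : int, group_det x = 9 * m + 1 \/ group_det x = 9 * m - 1) \/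
  exists m : int, group_det x = 3 ^+ 6 * m.
Proof.
rewrite group_det_Z3sq !eisenstein_norm_sum /=.
move: (x (0, 0)) (x (0, 1)) (x (0, 1 + 1)) (x (1, 0)) (x (1, 1)) (x (1, 1 + 1))
  (x (1 + 1, 0)) (x (1 + 1, 1)) (x (1 + 1, 1 + 1)).
move=> a b c d e f g h i.
set s := a + b + c + d + e + f + g + h + i.
have -> : a + b + c + (d + e + f) + (g + h + i) = s by rewrite /s; ring.
have -> : a + d + g + (b + e + h) + (c + f + i) = s by rewrite /s; ring.
have -> : a + f + h + (b + d + i) + (c + e + g) = s by rewrite /s; ring.
have -> : a + e + i + (b + f + g) + (c + d + h) = s by rewrite /s; ring.
set e1 := (a + b + c) * _ + _ + _; set e2 := (a + d + g) * _ + _ + _.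
set e3 := (a + f + h) * _ + _ + _; set e4 := (a + e + i) * _ + _ + _.
(* Two points of the plane are joined by exactly one line, hence lie on
   distinct lines of three of the four parallel classes. *)
have sumE : e1 + e2 + e3 + e4 = 3 * (
    a * (b + c + d + e + f + g + h + i) + b * (c + d + e + f + g + h + i) +
    c * (d + e + f + g + h + i) + d * (e + f + g + h + i) +
    e * (f + g + h + i) + f * (g + h + i) + g * (h + i) + h * i).
  by rewrite /e1 /e2 /e3 /e4; ring.
have [k [sE|sE|sE]] := modz3_cases s.
- right; rewrite sE; apply: (norm_product_dvd3 _ sumE);
    by apply: (@pair_sum_mod3 _ _ _ k); rewrite -sE /s; ring.
- have [q ->] := norm_product_coprime s sumE; left.
  (* From [s ^+ 9 - 1 = (s ^+ 3 - 1) * (s ^+ 6 + s ^+ 3 + 1)], where [s ^+ 3 - 1] is 9 times the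
     cubic in [k]; the next case factors [s ^+ 9 + 1] likewise. *)
  exists (q + ((3 * k ^+ 3 + 3 * k ^+ 2 + k) * (s ^+ 6 + s ^+ 3 + 1))); left.
  by move: (s) sE => {}s ->; ring.
- have [q ->] := norm_product_coprime s sumE; left.
  exists (q + ((3 * k ^+ 3 - 3 * k ^+ 2 + k) * (s ^+ 6 - s ^+ 3 + 1))); right.
  by move: (s) sE => {}s ->; ring.
Qed.

(* Row-major listing [s] of a 3 x 3 array, padded with zeros and shifted by [m]. *)
Definition array_fun (s : seq int) (m : int) (g : 'Z_3 * 'Z_3) : int :=
  m + s`_(3 * g.1 + g.2).

Theorem theorem6p1 :
  group_det_set ('Z_3 * 'Z_3)%type =
    [set z : int | exists m : int, z = 9 * m + 1 \/ z = 9 * m - 1] `|`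
    [set z : int | exists m : int, z = 3 ^+ 6 * m].
Proof.
have detE s m := group_det_Z3sq (array_fun s m).
apply/seteqP; split => [_ [x _ <-]|z].
  exact: group_det_Z3sq_mod.
case=> [[m [->|->]]|[m ->]].
(* A single nonzero entry 1 or -1 makes all four norms 1. *)
- exists (array_fun [:: 1] m) => //.
  rewrite detE /array_fun /eisenstein_norm /=; ring.
- exists (array_fun [:: -1] m) => //.
  rewrite detE /array_fun /eisenstein_norm /=; ring.
(* For [m = 3 * q + r], [3 ^+ 6 * m] is [3 ^+ 5 * (9 * q + 3 * r)]: the array needs entry sum
   [3 * r] before the shift by [q]. In each array three norms are 3 and one is 9. *)
- have [q [->|->|->]] := modz3_cases m.
  + exists (array_fun [:: 0; 0; 0; 0; 0; 1; 1; -1; -1] q) => //.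
    rewrite detE /array_fun /eisenstein_norm /=; ring.
  + exists (array_fun [:: 0; 0; 0; 0; 1; 1; 1; 1; -1] q) => //.
    rewrite detE /array_fun /eisenstein_norm /=; ring.
  + exists (array_fun [:: 0; 0; 0; 0; 1; -1; -1; -1; -1] q) => //.
    rewrite detE /array_fun /eisenstein_norm /=; ring.
Qed.
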